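(* Let $S,Q\in\mathbb{R}^{\nu\times\nu}$ have negative real eigenvalues and be such that $S=T^{-1}\Lambda_ST$, $Q=Z\Lambda_QZ^{-1}$, with $\Lambda_S<0$, $\Lambda_Q<0$ diagonal and $T,Z$ nonsingular real matrices. (1) Let $F_1=T^\top D_ST$, $F_2=T^\top E_ST$, $G=L^\top$, with diagonal matrices $D_S>0$ and $E_S$ such that $0<E_S<-D_S\Lambda_S^{-1}$. Then the reduced system $\widehat\Sigma_G$ is asymptotically stable. (2) Let $F_1=ZD_QZ^\top$, $F_2=ZE_QZ^\top$, $H_0=R^\top$, $H_1=R^\top Q^\top$, with diagonal matrices $D_Q>0$ and $E_Q$ such that $0<E_Q<-D_Q\Lambda_Q^{-1}$. Then the reduced system $\widehat\Sigma_H$ is asymptotically stable.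
   Context: $\Sigma$ is the single-input single-output second-order system $M\ddot x+D\dot x+Kx=Bu$, $y=C_1\dot x+C_0x$, with $M,D,K\in\mathbb{R}^{n\times n}$, $B\in\mathbb{R}^{n}$, $C_0,C_1\in\mathbb{R}^{1\times n}$, and $\Omega=\{s\in\mathbb{C}:\det(Ms^2+Ds+K)=0\}$. $L\in\mathbb{R}^{1\times\nu}$ and $R\in\mathbb{R}^\nu$ are such that $(L,S)$ is observable and $(Q,R)$ is controllable; $\sigma(S)\cap\Omega=\sigma(Q)\cap\Omega=\emptyset$; $\Pi\in\mathbb{R}^{n\times\nu}$ and $\Upsilon\in\mathbb{R}^{\nu\times n}$ are the unique solutions of $M\Pi S^2+D\Pi S+K\Pi=BL$ and $Q^2\Upsilon M+Q\Upsilon D+\Upsilon K=RC_0+QRC_1$. $\widehat\Sigma_G$: $F_2\ddot\xi+F_1\dot\xi+(GL-F_2S^2-F_1S)\xi=Gu$, $\psi=H_1\dot\xi+(C_0\Pi+C_1\Pi S-H_1S)\xi$, with parameters $F_1,F_2\in\mathbb{R}^{\nu\times\nu}$, $G\in\mathbb{R}^\nu$, $H_1\in\mathbb{R}^{1\times\nu}$. $\widehat\Sigma_H$: $F_2\ddot\xi+F_1\dot\xi+(RH_0+QRH_1-Q^2F_2-QF_1)\xi=\Upsilon Bu$, $\psi=H_1\dot\xi+H_0\xi$, with parameters $F_1,F_2\in\mathbb{R}^{\nu\times\nu}$, $H_0,H_1\in\mathbb{R}^{1\times\nu}$. For a real symmetric matrix, $X>0$ ($X<0$) means positive (negative) definite.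 Asymptotic stability: with $u=0$, $(\xi(t),\dot\xi(t))\to0$ as $t\to\infty$ for all initial conditions. *)

(* Defs.v *)
From HB Require Import structures.
From mathcomp Require Import all_boot all_order all_algebra.
From mathcomp Require Import all_classical all_reals all_analysis.
From mathcomp Require Import complex.

Set Implicit Arguments.
Unset Strict Implicit.
Unset Printing Implicit Defensive.

Import Order.TTheory GRing.Theory Num.Theory.
Import numFieldNormedType.Exports.

Local Open Scope classical_set_scope.
Local Open Scope ring_scope.
Local Open Scope complex_scope.

Section Matrices.
Variable R : realType.

Definition posdef n (X : 'M[R]_n) : Prop :=
  X^T = X /\ forall v : 'cV[R]_n, v != 0 -> 0 < (v^T *m X *m v) 0 0.

Definition negdef n (X : 'M[R]_n) : Prop :=
  X^T = X /\ forall v : 'cV[R]_n, v != 0 -> (v^T *m X *m v) 0 0 < 0.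

Definition mxlt n (X Y : 'M[R]_n) : Prop := posdef (Y - X).

Definition complex_mx m n (A : 'M[R]_(m, n)) : 'M[R[i]]_(m, n) :=
  map_mx (real_complex R) A.

(* The order of R[i] is partial: s < 0 there means that s is real and negative. *)
Definition spectrum n (A : 'M[R]_n) : set R[i] :=
  [set s | eigenvalue (complex_mx A) s].

Definition observability_mx n (L : 'rV[R]_n) (S : 'M[R]_n) : 'M[R]_n :=
  \matrix_(i < n) (L *m S ^+ i).

Definition controllability_mx n (Q : 'M[R]_n) (r : 'cV[R]_n) : 'M[R]_n :=
  \matrix_(i < n, j < n) (Q ^+ j *m r) i 0.

Definition observable n (L : 'rV[R]_n) (S : 'M[R]_n) : Prop :=
  \rank (observability_mx L S) = n.

Definition controllable n (Q : 'M[R]_n) (r : 'cV[R]_n) : Prop :=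
  \rank (controllability_mx Q r) = n.

End Matrices.

(* The system  mass x'' + damping x' + stiffness x = input u,
               y = out1 x' + out0 x. *)
Record so_system (R : realType) (n : nat) := SOSystem {
  mass : 'M[R]_n;
  damping : 'M[R]_n;
  stiffness : 'M[R]_n;
  input : 'cV[R]_n;
  out1 : 'rV[R]_n;
  out0 : 'rV[R]_n }.

Section Systems.
Variable R : realType.

Definition char_zeros n (Sg : so_system R n) : set R[i] :=
  [set s | \det (s ^+ 2 *: complex_mx (mass Sg) + s *: complex_mx (damping Sg)
                 + complex_mx (stiffness Sg)) = 0].

(* Trajectories live on t > 0; the initial position x0 and velocity v0 are
   attained as right limits at 0. *)
Definition trajectory n (Sg : so_system R n) (u : R -> R) (x0 v0 : 'cV[R]_n)
    (x : R -> 'cV[R]_n) : Prop :=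
  [/\ forall t : R, 0 < t -> derivable x t 1,
      forall t : R, 0 < t -> derivable (derive1 x) t 1,
      forall t : R, 0 < t ->
        mass Sg *m derive1 (derive1 x) t + damping Sg *m derive1 x t
        + stiffness Sg *m x t
        = u t *: input Sg,
      x t @[t --> 0^'+] --> x0 &
      derive1 x t @[t --> 0^'+] --> v0].

(* Solvability from every initial condition is part of the notion, so that it
   does not hold vacuously when the mass matrix is singular. *)
Definition asymptotically_stable n (Sg : so_system R n) : Prop :=
  forall x0 v0 : 'cV[R]_n,
    (exists x, trajectory Sg (fun=> 0) x0 v0 x) /\
    (forall x, trajectory Sg (fun=> 0) x0 v0 x ->
       x t @[t --> +oo] --> (0 : 'cV[R]_n) /\
       derive1 x t @[t --> +oo] --> (0 : 'cV[R]_n)).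

Definition right_sylvester n nu (Sg : so_system R n) (S : 'M[R]_nu)
    (L : 'rV[R]_nu) (P : 'M[R]_(n, nu)) : Prop :=
  mass Sg *m P *m S ^+ 2 + damping Sg *m P *m S + stiffness Sg *m P
  = input Sg *m L.

Definition left_sylvester n nu (Sg : so_system R n) (Q : 'M[R]_nu)
    (r : 'cV[R]_nu) (U : 'M[R]_(nu, n)) : Prop :=
  Q ^+ 2 *m U *m mass Sg + Q *m U *m damping Sg + U *m stiffness Sg
  = r *m out0 Sg + Q *m r *m out1 Sg.

Definition reduced_G n nu (Sg : so_system R n) (S : 'M[R]_nu) (L : 'rV[R]_nu)
    (P : 'M[R]_(n, nu)) (F1 F2 : 'M[R]_nu) (G : 'cV[R]_nu) (H1 : 'rV[R]_nu) :
    so_system R nu :=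
  {| mass := F2;
     damping := F1;
     stiffness := G *m L - F2 *m S ^+ 2 - F1 *m S;
     input := G;
     out1 := H1;
     out0 := out0 Sg *m P + out1 Sg *m P *m S - H1 *m S |}.

Definition reduced_H n nu (Sg : so_system R n) (Q : 'M[R]_nu) (r : 'cV[R]_nu)
    (U : 'M[R]_(nu, n)) (F1 F2 : 'M[R]_nu) (H0 H1 : 'rV[R]_nu) :
    so_system R nu :=
  {| mass := F2;
     damping := F1;
     stiffness := r *m H0 + Q *m r *m H1 - Q ^+ 2 *m F2 - Q *m F1;
     input := U *m input Sg;
     out1 := H1;
     out0 := H0 |}.

End Systems.

(* Main.v *)
(* In the modal coordinates of [S], resp. [Q], the assumption
   [0 < E < - D Lambda^-1] says that [- Lambda (E Lambda + D) > 0], so the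
   stiffness matrix of the reduced system is a Gram matrix plus a positive
   definite one. A system with positive definite mass M, damping D and
   stiffness K is exponentially stable, because for small [e > 0] the perturbed
   energy [v^T M v + x^T K x + 2 e x^T M v], with [v = x'], is coercive and
   decays at a rate proportional to itself. Since M is invertible, solutions
   exist: their Taylor coefficients obey a linear recurrence, hence grow at
   most geometrically. *)
Require Import Defs.
From HB Require Import structures.
From mathcomp Require Import all_boot all_order all_algebra.
From mathcomp Require Import all_classical all_reals all_analysis.
From mathcomp Require Import complex ring lra.
Set Implicit Arguments.
Unset Strict Implicit.
Unset Printing Implicit Defensive.
Import Order.TTheory GRing.Theory Num.Theory.
Import numFieldNormedType.Exports.
Local Open Scope classical_set_scope.
Local Open Scope ring_scope.
Local Open Scope complex_scope.

(** * Quadratic forms of positive definite matrices *)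

Section BilinearForm.
Variable R : realType.

Definition bilf n (X : 'M[R]_n) (u w : 'cV[R]_n) : R := (u^T *m X *m w) 0 0.

(** The squared Euclidean norm is polynomial in the coordinates, so it suits estimates on quadratic
    forms better than the sup norm carried by matrices. *)
Definition sqnorm n (v : 'cV[R]_n) : R := \sum_i v i 0 ^+ 2.

Lemma bilfE n (X : 'M[R]_n) u w :
  bilf X u w = \sum_i \sum_j u i 0 * X i j * w j 0.
Proof.
rewrite /bilf mxE exchange_big /=; apply: eq_bigr => j _.
rewrite mxE mulr_suml; apply: eq_bigr => i _.
by rewrite mxE.
Qed.

Lemma bilfDl n (X : 'M[R]_n) u1 u2 w :
  bilf X (u1 + u2) w = bilf X u1 w + bilf X u2 w.
Proof. by rewrite /bilf linearD/= !mulmxDl mxE. Qed.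

Lemma bilfDr n (X : 'M[R]_n) u w1 w2 :
  bilf X u (w1 + w2) = bilf X u w1 + bilf X u w2.
Proof. by rewrite /bilf !mulmxDr mxE. Qed.

Lemma bilfZl n (X : 'M[R]_n) a u w : bilf X (a *: u) w = a * bilf X u w.
Proof. by rewrite /bilf linearZ/= -!scalemxAl mxE. Qed.

Lemma bilfZr n (X : 'M[R]_n) a u w : bilf X u (a *: w) = a * bilf X u w.
Proof. by rewrite /bilf -!scalemxAr mxE. Qed.

Lemma bilf_sym n (X : 'M[R]_n) u w : X^T = X -> bilf X u w = bilf X w u.
Proof.
move=> symX; rewrite /bilf -[u^T *m _ *m _]trmxK mxE.
by rewrite !trmx_mul trmxK symX mulmxA.
Qed.

Lemma posdef_bilf_ge0 n (X : 'M[R]_n) v : posdef X -> 0 <= bilf X v v.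
Proof.
case=> _ pX; have [->|/pX/ltW//] := eqVneq v 0.
by rewrite /bilf mulmx0 mxE.
Qed.

Lemma posdef_unitmx n (X : 'M[R]_n) : posdef X -> X \in unitmx.
Proof.
case=> symX pX; rewrite -row_free_unit -kermx_eq0; apply/rowV0P.
move=> v /sub_kermxP vX0.
apply/eqP; rewrite -trmx_eq0; apply/negPn/negP => /pX.
by rewrite trmxK vX0 mul0mx mxE ltxx.
Qed.

Lemma posdef_CauchySchwarz n (X : 'M[R]_n) u w : posdef X ->
  bilf X u w ^+ 2 <= bilf X u u * bilf X w w.
Proof.
move=> pX; have [->|w0] := eqVneq w 0.
  by rewrite /bilf !mulmx0 mxE expr0n mulr0.
have q0 : 0 < bilf X w w by case: pX => _; apply.
(* This vector is [bilf X w w] times the part of [u] orthogonal to [w] for [X]; the scaling avoids a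
   division. *)
have := posdef_bilf_ge0 (bilf X w w *: u + (- bilf X u w) *: w) pX.
rewrite !(bilfDl, bilfDr, bilfZl, bilfZr) [bilf X w u]bilf_sym;
  last by case: pX.
set q := bilf X w w in q0 *; set p := bilf X u w; set s := bilf X u u.
rewrite (_ : _ + _ = q * (s * q - p ^+ 2)); last by ring.
by rewrite pmulr_rge0// subr_ge0.
Qed.

Lemma sqnorm_ge0 n (v : 'cV[R]_n) : 0 <= sqnorm v.
Proof. by apply: sumr_ge0 => i _; exact: sqr_ge0. Qed.

Lemma sqnorm_ge_coord n (v : 'cV[R]_n) i : v i 0 ^+ 2 <= sqnorm v.
Proof.
rewrite /sqnorm (bigD1 i)//= lerDl; apply: sumr_ge0 => j _; exact: sqr_ge0.
Qed.

(* [v i 0] is the inner product of [X^-1 e_i] and [v] for the form [X]. *)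
Lemma posdef_coercive n (X : 'M[R]_n) : posdef X ->
  exists2 c, 0 < c & forall v, c * sqnorm v <= bilf X v v.
Proof.
move=> pX; pose f i : 'cV[R]_n := invmx X *m delta_mx i 0.
pose C := \sum_i bilf X (f i) (f i).
have C0 : 0 <= C by apply: sumr_ge0 => i _; exact: posdef_bilf_ge0.
(* Adding 1 keeps the constant invertible when [n = 0], where [C] is an empty sum. *)
exists (C + 1)^-1 => [|v]; first by rewrite invr_gt0; lra.
rewrite mulrC ler_pdivrMr; last lra.
have symX : X^T = X by case: pX.
suff : sqnorm v <= bilf X v v * C.
  by have := posdef_bilf_ge0 v pX; rewrite mulrDr mulr1; lra.
rewrite /sqnorm mulr_sumr; apply: ler_sum => i _.
rewrite (_ : v i 0 = bilf X (f i) v);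
  first by rewrite mulrC posdef_CauchySchwarz.
rewrite /bilf /f trmx_mul trmx_inv symX -(mulmxA _ (invmx X)).
by rewrite mulVmx ?posdef_unitmx// mulmx1 trmx_delta -rowE mxE.
Qed.

(** Entrywise, [|u_i| |w_j| <= u_i^2 + w_j^2]. The 1 added to the constant keeps it positive when
    [X = 0]. *)
Lemma bilf_bounded n (X : 'M[R]_n) :
  exists2 c, 0 < c & forall u w, `|bilf X u w| <= c * (sqnorm u + sqnorm w).
Proof.
exists (\sum_i \sum_j `|X i j| + 1) => [|u w].
  by rewrite ltr_wpDl// sumr_ge0// => i _; rewrite sumr_ge0.
have N0 : 0 <= sqnorm u + sqnorm w by rewrite addr_ge0 ?sqnorm_ge0.
rewrite mulrDl mul1r ler_wpDr// bilfE mulr_suml.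
rewrite (le_trans (ler_norm_sum _ _ _))//; apply: ler_sum => i _.
rewrite mulr_suml (le_trans (ler_norm_sum _ _ _))//; apply: ler_sum => j _.
rewrite !normrM mulrAC mulrC ler_wpM2l//.
have := sqnorm_ge_coord u i; have := sqnorm_ge_coord w j.
rewrite -[u i 0 ^+ 2]real_normK ?num_real// -[w j 0 ^+ 2]real_normK ?num_real//.
move: (`|u i 0|) (`|w j 0|) => a b; nra.
Qed.

Lemma posdef_congr n (X A : 'M[R]_n) :
  A \in unitmx -> posdef X -> posdef (A^T *m X *m A).
Proof.
move=> uA [symX pX]; split; first by rewrite !trmx_mul trmxK symX mulmxA.
move=> v v0; have /pX : A *m v != 0.
  by apply: contra_neq v0 => Av0; rewrite -(mulKmx uA v) Av0 mulmx0.
by rewrite trmx_mul !mulmxA.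
Qed.

Lemma posdef_addr_gram n m (X : 'M[R]_n) (A : 'M[R]_(m, n)) :
  posdef X -> posdef (A^T *m A + X).
Proof.
move=> [symX pX]; split; first by rewrite linearD/= trmx_mul trmxK symX.
move=> v /pX vXv; rewrite mulmxDr mulmxDl mxE ltr_wpDl//.
rewrite mulmxA -mulmxA -trmx_mul mxE sumr_ge0// => i _.
by rewrite mxE -expr2 sqr_ge0.
Qed.

End BilinearForm.

(** * Power series with factorial denominators *)

Section ExponentialGeneratingFunction.
Variable R : realType.
Implicit Types a : R^nat.

(** Dividing by [k!] turns differentiation into the shift of [a], so a linear recurrence on [a]
    becomes a linear differential equation. *)
Definition egf a (t : R) : R := limn (pseries (fun k => a k / k`!%:R) t).

(** This condition makes [egf a] converge everywhere and is preserved by the shift, hence by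
    differentiation. *)
Definition geometric_growth a : Prop :=
  exists b c : R, [/\ 0 <= b, 0 <= c & forall k, `|a k| <= b * c ^+ k].

Lemma geometric_growth_shift a :
  geometric_growth a -> geometric_growth (fun k => a k.+1).
Proof.
move=> [b [c [b0 c0 abc]]]; exists (b * c), c; split=> // [|k].
  exact: mulr_ge0.
by rewrite -mulrA -exprS.
Qed.

(** Comparison with [b] times the exponential series at [c |t|]. *)
Lemma is_cvg_egf a t : geometric_growth a ->
  cvgn (pseries (fun k => a k / k`!%:R) t).
Proof.
move=> [b [c [b0 c0 abc]]]; apply: normed_cvg.
apply: (@series_le_cvg _ _ (b *: exp_coeff (c * `|t|))) => [k|k|k|].
- exact: normr_ge0.
- by rewrite mulr_ge0// divr_ge0// exprn_ge0// mulr_ge0.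
- rewrite -[leRHS]/(b * ((c * `|t|) ^+ k / k`!%:R)).
  rewrite -[leLHS]/(`|a k / k`!%:R * t ^+ k|).
  rewrite exprMn !normrM normfV normrX [`|_%:R|]ger0_norm//.
  rewrite mulrAC !mulrA ler_wpM2r ?invr_ge0// ler_wpM2r ?exprn_ge0//.
- by apply: is_cvg_seriesZ; exact: is_cvg_series_exp_coeff.
Qed.

Lemma pseries_diffs_egf a :
  pseries_diffs (fun k => a k / k`!%:R) = (fun k => a k.+1 / k`!%:R).
Proof.
apply/funext => k; rewrite /pseries_diffs factS natrM invfM.
by rewrite mulrCA mulVKf// pnatr_eq0.
Qed.

Lemma is_derive_egf a (t : R) : geometric_growth a ->
  is_derive t 1 (egf a) (egf (fun k => a k.+1) t).
Proof.
move=> ga; rewrite /egf -pseries_diffs_egf.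
(* Termwise differentiation needs the series and its first two derived series to converge at a point
   of modulus above [|t|]; [|t| + 1] is one. *)
have cv b := @is_cvg_egf b (`|t| + 1).
apply: (@pseries_snd_diffs _ _ (`|t| + 1)); rewrite ?pseries_diffs_egf.
- exact: cv.
- exact/cv/geometric_growth_shift.
- exact/cv/(@geometric_growth_shift (fun k => a k.+1))/geometric_growth_shift.
- by rewrite [X in _ < X]ger0_norm ?ltrDl.
Qed.

Lemma egf0 a : egf a 0 = a 0%N.
Proof.
apply/cvg_lim => //; apply: cvg_near_cst; near=> m.
rewrite /pseries /series/= -(@prednK m); last by near: m; exists 1%N.
rewrite big_nat_recl//= big1 => [|k _]; last by rewrite expr0n mulr0.
by rewrite expr0 mulr1 fact0 divr1 addr0.
Unshelve. all: by end_near. Qed.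

(** Carries a linear recurrence over from the coefficients to the functions. *)
Lemma egf_sum (I : Type) (s : seq I) (c : I -> R) (a : I -> R^nat) t :
  (forall i, geometric_growth (a i)) ->
  egf (fun k => \sum_(i <- s) c i * a i k) t = \sum_(i <- s) c i * egf (a i) t.
Proof.
move=> ga; apply/cvg_lim => //.
rewrite (_ : pseries _ _ = fun n => \sum_(i <- s)
   c i * pseries (fun k => a i k / k`!%:R) t n).
  apply: cvg_big => [|i _].
    exact: add_continuous.
  by apply: cvgMr; exact: is_cvg_egf.
apply/funext => n; rewrite /pseries/series/=.
under [RHS]eq_bigr do rewrite mulr_sumr.
rewrite exchange_big/=; apply: eq_bigr => k _.
by rewrite !mulr_suml; apply: eq_bigr => i _; rewrite !mulrA.
Qed.

End ExponentialGeneratingFunction.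

(** * Power series solutions of [x'' = A x' + B x] *)

Section SecondOrderLinearODE.
Variables (R : realType) (n : nat) (A B : 'M[R]_n) (x0 v0 : 'cV[R]_n).

(** These are the derivatives of the solution at 0, without factorials. The nested match keeps both
    recursive calls structural. *)
Fixpoint taylor_coeff k : 'cV[R]_n :=
  match k with
  | 0 => x0
  | k'.+1 => match k' with
             | 0 => v0
             | k''.+1 => A *m taylor_coeff k' + B *m taylor_coeff k''
             end
  end.

Lemma taylor_coeffSS k : taylor_coeff k.+2 =
  A *m taylor_coeff k.+1 + B *m taylor_coeff k.
Proof. by []. Qed.

Lemma mulmx_norm_bounded (X : 'M[R]_n) :
  exists2 c, 0 <= c & forall v : 'cV[R]_n, `|X *m v| <= c * `|v|.
Proof.
have c0 : 0 <= \sum_i \sum_j `|X i j|.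
  by apply: sumr_ge0 => i _; exact: sumr_ge0.
exists (\sum_i \sum_j `|X i j|) => // v.
rewrite [leLHS]/Num.Def.normr/= mx_normrE.
apply: bigmax_le => [|[i j] _ /=]; first exact: mulr_ge0.
rewrite mxE (le_trans (ler_norm_sum _ _ _))//.
rewrite [leRHS]mulr_suml [leRHS](bigD1 i)//= ler_wpDr//.
  by apply: sumr_ge0 => k _; rewrite mulr_ge0// sumr_ge0.
rewrite mulr_suml; apply: ler_sum => k _; rewrite normrM ler_wpM2l//.
rewrite [leRHS]/Num.Def.normr/= mx_normrE.
by apply: le_trans (le_bigmax _ _ (k, j)); rewrite lexx.
Qed.

(** Two consecutive coefficients are bounded together by induction. Since [c >= 1], the bound
    [b c^k] is nondecreasing, so the recurrence multiplies it by at most [cA + cB <= c]. *)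
Lemma taylor_coeff_growth i : geometric_growth (fun k => taylor_coeff k i 0).
Proof.
have [cA cA0 hA] := mulmx_norm_bounded A.
have [cB cB0 hB] := mulmx_norm_bounded B.
pose c := 1 + cA + cB; pose b := `|x0| + `|v0|.
have c1 : 1 <= c by rewrite /c; lra.
have b0 : 0 <= b by rewrite addr_ge0.
have ab k : `|taylor_coeff k| <= b * c ^+ k /\
            `|taylor_coeff k.+1| <= b * c ^+ k.+1.
  elim: k => [|k [IH0 IH1]].
    rewrite /= expr0 mulr1 expr1 lerDl normr_ge0; split=> //.
    by rewrite (@le_trans _ _ b)// ?lerDr// ler_peMr.
  split=> //; rewrite taylor_coeffSS (le_trans (ler_normD _ _))//.
  rewrite (le_trans (lerD (hA _) (hB _)))//.
  have : b * c ^+ k <= b * c ^+ k.+1.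
    by rewrite ler_wpM2l// exprS ler_peMl// exprn_ge0//; lra.
  rewrite [c ^+ k.+2]exprS mulrCA.
  set e := b * c ^+ k.+1 in IH1 *; set e' := b * c ^+ k in IH0 *.
  move=> ee; have e0 : 0 <= e by apply: le_trans IH1.
  have := ler_wpM2l cA0 IH1; have := ler_wpM2l cB0 (le_trans IH0 ee).
  by rewrite /c; lra.
exists b, c; split=> [//||k]; first lra.
apply: le_trans (ab k).1; rewrite [leRHS]/Num.Def.normr/= mx_normrE.
exact: le_trans (le_bigmax _ _ (i, 0)).
Qed.

Lemma linear_ode2_solution : exists x : R -> 'cV[R]_n,
  [/\ forall t, derivable x t 1, forall t, derivable (derive1 x) t 1,
      forall t, derive1 (derive1 x) t = A *m derive1 x t + B *m x t,
      x 0 = x0 & derive1 x 0 = v0].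
Proof.
(* [f m] is the [m]-th derivative of the solution [f 0]. *)
pose f (m : nat) t : 'cV[R]_n :=
  \col_i egf (fun k => taylor_coeff (k + m) i 0) t.
have gf m i : geometric_growth (fun k => taylor_coeff (k + m) i 0).
  elim: m => [|m IH].
    by under eq_fun do rewrite addn0; exact: taylor_coeff_growth.
  by under eq_fun do rewrite addnS; exact: geometric_growth_shift IH.
have Hf m (t : R) i j : is_derive t 1 (fun t => f m t i j) (f m.+1 t i j).
  have -> : (fun t => f m t i j) = egf (fun k => taylor_coeff (k + m) i 0).
    by apply/funext => u; rewrite mxE.
  have -> : f m.+1 t i j = egf (fun k => taylor_coeff (k.+1 + m) i 0) t.
    by rewrite mxE; under eq_fun do rewrite addnS -addSn.
  exact: is_derive_egf.
have dfm m t : derivable (f m) t 1.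
  by apply/derivable_mxP => i j; case: (Hf m t i j).
have df m : derive1 (f m) = f m.+1.
  apply/funext => t; rewrite derive1E derive_mx//; apply/matrixP => i j.
  by rewrite mxE; case: (Hf m t i j).
exists (f 0%N); rewrite !df; split=> // [t||].
(* Indexing by a disjoint union merges the two matrix products into one sum, so that [egf_sum]
   applies once to the whole recurrence. *)
- pose c i (s : 'I_n + 'I_n) :=
    match s with inl j => A i j | inr j => B i j end.
  pose a (s : 'I_n + 'I_n) k := match s with
    | inl j => taylor_coeff (k + 1) j 0 | inr j => taylor_coeff (k + 0) j 0 end.
  have ga s : geometric_growth (a s) by case: s => j; exact: gf.
  apply/colP => i; have := egf_sum (index_enum _) (c i) t ga.
  rewrite big_sumType/= mxE [X in _ = X + _ -> _](_ : _ = (A *m f 1%N t) i 0).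
    rewrite [X in _ = _ + X -> _](_ : _ = (B *m f 0%N t) i 0).
      move=> e; rewrite [RHS]mxE -e; congr (egf _ t); apply/funext => k.
      by rewrite big_sumType/= addn2 taylor_coeffSS !mxE addn1 addn0.
    by rewrite mxE; apply: eq_bigr => j _; rewrite mxE.
  by rewrite mxE; apply: eq_bigr => j _; rewrite mxE.
- by apply/colP => i; rewrite mxE egf0.
- by apply/colP => i; rewrite mxE egf0.
Qed.

End SecondOrderLinearODE.

(** * Exponential decay of the perturbed energy *)

Section DampedMechanicalSystem.
Variable R : realType.

(** With [e = 0] the derivative along solutions is [- 2 v^T D v], which controls only [v]; the cross
    term brings in [- 2 e x^T K x]. *)
Definition energy n (M K : 'M[R]_n) (e : R) (x v : 'cV[R]_n) : R :=
  bilf M v v + bilf K x x + 2 * e * bilf M x v.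

(** Pure algebra on vectors: [w] stands for the acceleration, and the left side of the last
    inequality is then the time derivative of the energy. *)
Lemma energy_estimates n (M D K : 'M[R]_n) :
  posdef M -> posdef D -> posdef K ->
  exists e a g : R, [/\ 0 < a, 0 < g,
    forall x v, a * (sqnorm x + sqnorm v) <= energy M K e x v &
    forall x v w, M *m w + D *m v + K *m x = 0 ->
      2 * (bilf M v w + bilf K x v + e * (bilf M v v + bilf M x w))
      <= - (g * energy M K e x v)].
Proof.
move=> pM pD pK.
have [m m0 hm] := posdef_coercive pM.
have [d d0 hd] := posdef_coercive pD.
have [k k0 hk] := posdef_coercive pK.
have [cM cM0 hcM] := bilf_bounded M.
have [cD cD0 hcD] := bilf_bounded D.
have [cK cK0 hcK] := bilf_bounded K.
have [mu [mu0 mum mud muk]] :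
    exists mu, [/\ 0 < mu, mu <= m, mu <= d & mu <= k].
  exists (Num.min m (Num.min d k)).
  by split; rewrite ?lt_min ?ge_min ?m0 ?d0 ?k0 ?lexx ?orbT.
have c0 : 0 < 8 * cM + 2 * cD by lra.
(* The bound on [e cM] serves the cross term of the energy and [2 e v^T M v]; the bound on [e cD]
   serves [e^2 x^T D x]. *)
pose e := mu / (8 * cM + 2 * cD).
have e0 : 0 < e by rewrite divr_gt0.
have ec : e * (8 * cM + 2 * cD) = mu by rewrite divfK// gt_eqF.
have ecM : e * cM <= mu / 8 by have := mulr_gt0 e0 cD0; nra.
have ecD : e * cD <= mu / 2 by have := mulr_gt0 e0 cM0; nra.
have low x v : mu / 2 * (sqnorm x + sqnorm v) <= energy M K e x v.
  have := hm v; have := hk x; have := hcM x v; rewrite ler_norml => /andP[h _].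
  have := ler_wpM2l (ltW e0) h.
  have := sqnorm_ge0 x; have := sqnorm_ge0 v; rewrite /energy.
  set Nx := sqnorm x; set Nv := sqnorm v => Nv0 Nx0.
  have := ler_wpM2r (addr_ge0 Nx0 Nv0) ecM.
  have := ler_wpM2r Nv0 mum; have := ler_wpM2r Nx0 muk.
  have := mulr_ge0 (ltW mu0) Nv0; have := mulr_ge0 (ltW mu0) Nx0.
  by lra.
pose h := Num.min (mu / 2) (e * mu).
have h0 : 0 < h by rewrite lt_min (mulr_gt0 e0 mu0) divr_gt0.
pose b := 2 * cM + 2 * cK + 2 * (e * cM).
have b0 : 0 < b by have := mulr_gt0 e0 cM0; rewrite /b; lra.
have upp x v : energy M K e x v <= b * (sqnorm x + sqnorm v).
  have := hcM v v; have := hcK x x; have := hcM x v.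
  rewrite !ler_norml => /andP[_ h1] /andP[_ h2] /andP[_ h3].
  have := ler_wpM2l (ltW e0) h1.
  have := sqnorm_ge0 x; have := sqnorm_ge0 v; rewrite /energy /b.
  set Nx := sqnorm x in h1 h2 h3 *; set Nv := sqnorm v in h1 h2 h3 * => Nv0 Nx0.
  have := mulr_ge0 (ltW cM0) Nx0; have := mulr_ge0 (ltW cK0) Nv0.
  by lra.
(* The energy loses at least [h] times the squared norms and is at most [b] times them, whence the
   rate [h / b]. *)
exists e, (mu / 2), (h / b); split=> //; [lra|exact: divr_gt0|].
move=> x v w Mw.
(* Pairing the equation of motion with [u] eliminates [w]. *)
have proj u : bilf M u w = - bilf D u v - bilf K u x.
  have bilf1 (X : 'M[R]_n) y : bilf X u y = bilf 1%:M u (X *m y).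
    by rewrite /bilf mulmx1 mulmxA.
  have : bilf 1%:M u (M *m w + D *m v + K *m x) = 0.
    by rewrite Mw /bilf mulmx0 mxE.
  by rewrite !bilfDr -!bilf1; lra.
have hb : h / b * energy M K e x v <= h * (sqnorm x + sqnorm v).
  by rewrite mulrAC ler_pdivrMr// -mulrA ler_pM2l// mulrC.
have symK : K^T = K by case: pK.
have symD : D^T = D by case: pD.
apply: le_trans (_ : - (h * (sqnorm x + sqnorm v)) <= _); last by rewrite lerN2.
rewrite !proj (bilf_sym v x symK).
(* Absorbs the cross term [2 e x^T D v] of the derivative of the energy. *)
have := posdef_bilf_ge0 (v + e *: x) pD.
rewrite !(bilfDl, bilfDr, bilfZl, bilfZr) (bilf_sym v x symD).
have := hd v; have := hk x; have := hcM v v; have := hcD x x.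
rewrite !ler_norml => /andP[_ h1] /andP[_ h2] h3 h4.
have := ler_wpM2l (ltW e0) h2; have := ler_wpM2l (ltW e0) h3.
have := ler_wpM2l (ltW e0) (ler_wpM2l (ltW e0) h1).
have := sqnorm_ge0 x; have := sqnorm_ge0 v.
set Nx := sqnorm x in h1 h2 h3 h4 *.
set Nv := sqnorm v in h1 h2 h3 h4 * => Nv0 Nx0.
(* What is left splits as [2 e v^T M v - v^T D v <= - (mu / 2) Nv] and
   [e^2 x^T D x - 2 e x^T K x <= - e mu Nx]. *)
have h_mu : h <= mu / 2 by rewrite ge_min lexx.
have h_emu : h <= e * mu by rewrite ge_min lexx orbT.
have := ler_wpM2r Nv0 h_mu; have := ler_wpM2r Nx0 h_emu.
have := ler_wpM2r Nv0 mud; have := ler_wpM2l (ltW e0) (ler_wpM2r Nx0 muk).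
have := ler_wpM2r Nv0 ecM; have := ler_wpM2l (ltW e0) (ler_wpM2r Nx0 ecD).
by lra.
Qed.

Lemma is_derive_bilf n (X : 'M[R]_n) (f g : R -> 'cV[R]_n) (t : R) :
  derivable f t 1 -> derivable g t 1 ->
  is_derive t 1 (fun s => bilf X (f s) (g s))
    (bilf X (derive1 f t) (g t) + bilf X (f t) (derive1 g t)).
Proof.
move=> df dg.
have coord (y : R -> 'cV[R]_n) i : derivable y t 1 ->
    is_derive t 1 (fun s => y s i 0) (derive1 y t i 0).
  move=> dy; have /derivable_mxP dyi := dy.
  by rewrite derive1E derive_mx// mxE; split.
rewrite (_ : (fun s => _) = \sum_i \sum_j
    ((fun s => X i j * f s i 0) * (fun s => g s j 0))); last first.
  apply/funext => s; rewrite fct_sumE bilfE; apply: eq_bigr => i _.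
  rewrite fct_sumE; apply: eq_bigr => j _.
  by rewrite [RHS]/(X i j * f s i 0 * g s j 0) [X in X * _]mulrC.
rewrite !bilfE -big_split/=; apply: is_derive_sum => i.
rewrite -big_split/=; apply: is_derive_sum => j.
have di := coord f i df; have dj := coord g j dg.
have dXi : is_derive t 1 (fun s => X i j * f s i 0) (X i j * derive1 f t i 0).
  exact: is_deriveZ.
apply: is_derive_eq.
by rewrite /GRing.scale/=; ring.
Qed.

(** The sup norm is at most [e] as soon as the squared Euclidean norm is at most [e^2]. *)
Lemma cvg_sqnorm0 n (y : R -> 'cV[R]_n) :
  (forall e, 0 < e -> \forall t \near +oo, sqnorm (y t) <= e) ->
  y t @[t --> +oo] --> (0 : 'cV[R]_n).
Proof.
move=> y0; apply/cvgr0Pnorm_le => e e0; have := y0 _ (exprn_gt0 2 e0).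
apply: filterS => t yt; rewrite [leLHS]/Num.Def.normr/= mx_normrE.
apply: bigmax_le => [|[i j] _ /=]; first exact: ltW.
rewrite -ler_sqr ?nnegrE ?(ltW e0)//.
rewrite real_normK ?num_real// ord1; apply: le_trans yt.
exact: sqnorm_ge_coord.
Qed.

(** Gronwall argument: the energy times [expR (g * t)] is nonincreasing. It starts at [t = 1]
    because derivatives are given only for [t > 0], while monotonicity is proved on a closed
    half-line. *)
Lemma posdef_trajectory_decay n (Sg : so_system R n) x0 v0 x :
  posdef (mass Sg) -> posdef (damping Sg) -> posdef (stiffness Sg) ->
  trajectory Sg (fun=> 0) x0 v0 x ->
  exists C g : R, 0 < g /\ forall t, 1 <= t ->
    sqnorm (x t) + sqnorm (derive1 x t) <= C / expR (g * t).
Proof.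
move=> pM pD pK [dx dv ode _ _].
have [e [a [g [a0 g0 low diss]]]] := energy_estimates pM pD pK.
set M := mass Sg in pM low diss ode; set K := stiffness Sg in pK low diss ode.
pose V t := energy M K e (x t) (derive1 x t).
pose W t := V t * expR (g * t).
pose dV t := 2 * (bilf M (derive1 x t) (derive1 (derive1 x) t)
  + bilf K (x t) (derive1 x t)
  + e * (bilf M (derive1 x t) (derive1 x t)
         + bilf M (x t) (derive1 (derive1 x) t))).
have isdV (t : R) : 0 < t -> is_derive t 1 V (dV t).
  move=> t0.
  have d1 := is_derive_bilf M (dv t t0) (dv t t0).
  have d2 := is_derive_bilf K (dx t t0) (dx t t0).
  have d3 := is_derive_bilf M (dx t t0) (dv t t0).
  have d4 := is_deriveZ (2 * e) d3.
  apply: (is_derive_eq (is_deriveD (is_deriveD d1 d2) d4)).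
  rewrite /dV (bilf_sym (derive1 (derive1 x) t) _ pM.1).
  rewrite (bilf_sym (derive1 x t) (x t) pK.1).
  by rewrite /GRing.scale/=; ring.
have isdW (t : R) : 0 < t -> is_derive t 1 W ((dV t + g * V t) * expR (g * t)).
  move=> t0; have d1 := isdV t t0.
  have d2 : is_derive t 1 (fun t : R => g * t) (g * 1) by exact: is_deriveZ.
  have d3 := is_derive1_comp (is_derive_expR (g * t)) d2.
  apply: (is_derive_eq (is_deriveM d1 d3)).
  by rewrite /GRing.scale/=; ring.
have Wle t : 1 <= t -> W t <= W 1.
  move=> t1; apply: (@ler0_derive1_nincry _ W 1) => // [u|u|].
  - rewrite in_itv/= andbT => u1; have /isdW : 0 < u by lra.
    by case.
  - rewrite in_itv/= andbT => u1; have u0 : 0 < u by lra.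
    rewrite derive1E; have [_ ->] := isdW _ u0.
    rewrite mulr_le0_ge0 ?expR_ge0//.
    have := diss (x u) (derive1 x u) (derive1 (derive1 x) u).
    by rewrite ode// scale0r => /(_ erefl); rewrite /dV /V; lra.
  - apply: derivable_within_continuous => u; rewrite in_itv/= andbT => u1.
    by have /isdW : 0 < u by lra; case.
exists (W 1 / a), g; split=> // t t1.
rewrite mulrAC ler_pdivlMr// mulrC ler_pdivlMr ?expR_gt0//.
by rewrite (le_trans _ (Wle t t1))// ler_wpM2r ?expR_ge0//; exact: low.
Qed.

Lemma posdef_asymptotically_stable n (Sg : so_system R n) :
  posdef (mass Sg) -> posdef (damping Sg) -> posdef (stiffness Sg) ->
  asymptotically_stable Sg.
Proof.
move=> pM pD pK x0 v0; split.
  have [x [dx dv ode xx0 vv0]] := linear_ode2_solution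
    (- (invmx (mass Sg) *m damping Sg)) (- (invmx (mass Sg) *m stiffness Sg))
    x0 v0.
  (* The power series solution lives on the whole line, so its initial values are also right
     limits. *)
  have cont (y : R -> 'cV[R]_n) : derivable y 0 1 -> y t @[t --> 0^'+] --> y 0.
    move=> /derivable1_diffP/differentiable_continuous.
    exact: cvg_at_right_filter.
  exists x; split=> // [t _||]; last 2 first.
  - by rewrite -xx0; exact: cont.
  - by rewrite -vv0; exact: cont.
  rewrite scale0r ode mulmxDr !mulNmx !mulmxN -!mulmxA.
  rewrite !mulKVmx ?posdef_unitmx//.
  by rewrite -addrA addrACA !addNr addr0.
move=> x /(posdef_trajectory_decay pM pD pK)[C [g [g0 Cg]]].
suff decay e : 0 < e -> \forall t \near +oo,
    sqnorm (x t) + sqnorm (derive1 x t) <= e.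
  by split; apply: cvg_sqnorm0 => e /decay; apply: filterS => t;
    apply: le_trans; rewrite ?lerDl ?lerDr sqnorm_ge0.
move=> e0; near=> t.
rewrite (le_trans (Cg t _))// ler_pdivrMr ?expR_gt0//.
(* From [t >= C / (e g)] and [expR (g * t) >= 1 + g * t] it follows that [C <= e * expR (g * t)]. *)
have h : C / (e * g) <= t by near: t; apply: nbhs_pinfty_ge; rewrite num_real.
rewrite (@le_trans _ _ (e * (1 + g * t)))//.
  by move: h; rewrite ler_pdivrMr ?mulr_gt0//; lra.
by rewrite ler_wpM2l ?(ltW e0)// expR_ge1Dx.
Unshelve. all: by end_near. Qed.

End DampedMechanicalSystem.

(** * Positive definiteness of the reduced stiffness matrices *)

Section ReducedStiffness.
Variables (R : realType) (n : nat).
Implicit Types Lambda D E T : 'M[R]_n.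

Lemma diag_mx_comm (X Y : 'M[R]_n) :
  is_diag_mx X -> is_diag_mx Y -> X *m Y = Y *m X.
Proof. by move=> /diag_mxP[x ->] /diag_mxP[y ->]; exact: diag_mxC. Qed.

(* Congruence by [Lambda] turns the bound [E < - D Lambda^-1] into
   [- Lambda D - Lambda E Lambda > 0]. *)
Lemma posdef_modal_stiffness Lambda D E :
  is_diag_mx Lambda -> is_diag_mx D -> is_diag_mx E -> negdef Lambda ->
  mxlt E (- (D *m invmx Lambda)) ->
  posdef (- (E *m Lambda *m Lambda) - D *m Lambda).
Proof.
move=> dL dD dE [symL nL].
have uL : Lambda \in unitmx.
  rewrite -[Lambda]opprK -scaleN1r unitmxZ ?unitrN1//.
  apply: posdef_unitmx; split; first by rewrite linearN/= symL.
  by move=> v /nL vLv; rewrite mulmxN mulNmx mxE oppr_gt0.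
move=> /(posdef_congr uL).
rewrite symL mulmxBr mulmxBl mulmxN mulNmx -!mulmxA mulVmx// mulmx1.
by rewrite mulmxA (diag_mx_comm dL dD) (diag_mx_comm dL dE) addrC mulmxA.
Qed.

(** Since [T S = Lambda T], the terms in [S] add up to [T^T W T], where [W] is the modal matrix
    assumed positive definite; [G = L^T] makes [G L] a Gram matrix. *)
Lemma posdef_stiffness_G Lambda D E T S (L : 'rV[R]_n) :
  T \in unitmx -> S = invmx T *m Lambda *m T ->
  posdef (- (E *m Lambda *m Lambda) - D *m Lambda) ->
  posdef (L^T *m L - T^T *m E *m T *m S ^+ 2 - T^T *m D *m T *m S).
Proof.
move=> uT ->; set W := _ - D *m Lambda => pW.
rewrite -addrA [X in _ + X](_ : _ = T^T *m W *m T).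
  by apply: posdef_addr_gram; exact: posdef_congr.
rewrite expr2 -mulmxE !mulmxA !(mulmxK uT).
by rewrite /W mulmxDr mulmxDl !mulmxN !mulNmx !mulmxA.
Qed.

(** Dual argument with [Q Z = Z Lambda]: the choice of [H0] and [H1] yields two Gram matrices, of
    [r^T] and of [(Q r)^T]. As [Q] acts from the left, so does [Lambda] in the modal matrix. *)
Lemma posdef_stiffness_H Lambda D E Z Q (r : 'cV[R]_n) :
  Z \in unitmx -> Q = Z *m Lambda *m invmx Z ->
  posdef (- (Lambda *m Lambda *m E) - Lambda *m D) ->
  posdef (r *m r^T + Q *m r *m (r^T *m Q^T)
          - Q ^+ 2 *m (Z *m E *m Z^T) - Q *m (Z *m D *m Z^T)).
Proof.
move=> uZ defQ; set W := _ - Lambda *m D => pW.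
have uZT : Z^T \in unitmx by rewrite unitmx_tr.
rewrite -!addrA [X in _ + (_ + X)](_ : _ = Z *m W *m Z^T).
  rewrite -trmx_mul -{1}[r]trmxK -{1}[Q *m r]trmxK.
  do 2 apply: posdef_addr_gram.
  by rewrite -{1}[Z]trmxK; exact: posdef_congr.
rewrite defQ expr2 -mulmxE !mulmxA !mulmxKV//.
by rewrite /W mulmxDr mulmxDl !mulmxN !mulNmx !mulmxA.
Qed.

End ReducedStiffness.

Theorem proposition4 (R : realType) (n nu : nat) (Sg : so_system R n)
    (S Q : 'M[R]_nu) (L : 'rV[R]_nu) (r : 'cV[R]_nu)
    (P : 'M[R]_(n, nu)) (U : 'M[R]_(nu, n))
    (T Z LambdaS LambdaQ : 'M[R]_nu)
    (obsLS : observable L S) (ctrQr : controllable Q r)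
    (specS : spectrum S `&` char_zeros Sg = set0)
    (specQ : spectrum Q `&` char_zeros Sg = set0)
    (defP : unique (right_sylvester Sg S L) P)
    (defU : unique (left_sylvester Sg Q r) U)
    (negS : forall s : R[i], spectrum S s -> s < 0)
    (negQ : forall s : R[i], spectrum Q s -> s < 0)
    (diagLS : is_diag_mx LambdaS) (negLS : negdef LambdaS)
    (diagLQ : is_diag_mx LambdaQ) (negLQ : negdef LambdaQ)
    (unitT : T \in unitmx) (unitZ : Z \in unitmx)
    (defS : S = invmx T *m LambdaS *m T)
    (defQ : Q = Z *m LambdaQ *m invmx Z) :
  (forall (DS ES : 'M[R]_nu) (H1 : 'rV[R]_nu),
     is_diag_mx DS -> is_diag_mx ES ->
     posdef DS -> posdef ES -> mxlt ES (- (DS *m invmx LambdaS)) ->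
     asymptotically_stable
       (reduced_G Sg S L P
          (T^T *m DS *m T) (* F1 *) (T^T *m ES *m T) (* F2 *)
          L^T (* G *) H1))
  /\
  (forall DQ EQ : 'M[R]_nu,
     is_diag_mx DQ -> is_diag_mx EQ ->
     posdef DQ -> posdef EQ -> mxlt EQ (- (DQ *m invmx LambdaQ)) ->
     asymptotically_stable
       (reduced_H Sg Q r U
          (Z *m DQ *m Z^T) (* F1 *) (Z *m EQ *m Z^T) (* F2 *)
          r^T (* H0 *) (r^T *m Q^T) (* H1 *))).
Proof.
split=> [DS ES H1 dDS dES pDS pES ltES|DQ EQ dDQ dEQ pDQ pEQ ltEQ].
  apply: posdef_asymptotically_stable => /=; try exact: posdef_congr.
  apply: posdef_stiffness_G defS _ => //.
  exact: posdef_modal_stiffness.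
have uZT : Z^T \in unitmx by rewrite unitmx_tr.
apply: posdef_asymptotically_stable => /=.
- by rewrite -{1}[Z]trmxK; exact: posdef_congr.
- by rewrite -{1}[Z]trmxK; exact: posdef_congr.
apply: posdef_stiffness_H defQ _ => //.
(* Diagonal matrices commute, which brings the left factors [LambdaQ] to the right, as in
   [posdef_modal_stiffness]. *)
rewrite (diag_mx_comm diagLQ dDQ) -mulmxA (diag_mx_comm diagLQ dEQ) mulmxA.
rewrite (diag_mx_comm diagLQ dEQ).
exact: posdef_modal_stiffness.
Qed.
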